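(* Let $n\ge 1$ and let $r,s,\alpha,\gamma\in\mathbf{R}$ with $r<s$, $r\neq 0$, $s>0$. Let $f$ be a measurable function on $\mathbf{R}^n$ with $f\in L^r_{loc}(\mathbf{R}^n,|x|^{n(\alpha-1)})$; in the case $r<0$ assume moreover that $f(x)\neq 0$ for almost every $x$. (i) If $\alpha-\gamma r/s>0$, then $$\int_{\mathbf{R}^n}|B(|y|)|^{\gamma-1}\big(M_r(f,\alpha)(|y|)\big)^s\,dy\le \frac{1}{(\alpha-\gamma r/s)^{s/r}}\int_{\mathbf{R}^n}|B(|y|)|^{\gamma-1}|f(y)|^s\,dy .$$ (ii) If $\alpha-\gamma r/s<0$, then $$\int_{\mathbf{R}^n}|B(|y|)|^{\gamma-1}\big(M^*_r(f,\alpha)(|y|)\big)^s\,dy\le \frac{1}{(\gamma r/s-\alpha)^{s/r}}\int_{\mathbf{R}^n}|B(|y|)|^{\gamma-1}|f(y)|^s\,dy .$$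
   Context: For $R>0$, $B(R)$ is the ball in $\mathbf{R}^n$ centered at the origin with radius $R$, and $|E|$ denotes the Lebesgue measure of a set $E$. The condition $f\in L^r_{loc}(\mathbf{R}^n,|x|^{n(\alpha-1)})$ means $\int_K|f(x)|^r|x|^{n(\alpha-1)}dx<\infty$ for every compact $K\subset\mathbf{R}^n$. For $r,\alpha\in\mathbf{R}$, $r\ne0$, and $y\neq 0$, the central integral mean of order $r$ with power weight and its companion mean are $$M_r(f,\alpha)(|y|)=\left[\frac{1}{|B(|y|)|^{\alpha}}\int_{B(|y|)}|B(|x|)|^{\alpha-1}|f(x)|^r\,dx\right]^{1/r},$$ $$M^*_r(f,\alpha)(|y|)=\left[\frac{1}{|B(|y|)|^{\alpha}}\int_{\mathbf{R}^n\setminus B(|y|)}|B(|x|)|^{\alpha-1}|f(x)|^r\,dx\right]^{1/r}.$$ All integrals are of nonnegative functions and take values in $[0,\infty]$; when $r<0$, $\infty^{1/r}=0$. The inequalities are understood in $[0,\infty]$. *)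

(* Defs.v *)
From HB Require Import structures.
From mathcomp Require Import all_boot all_order all_algebra.
From mathcomp Require Import all_classical all_reals all_analysis.

Set Implicit Arguments.
Unset Strict Implicit.
Unset Printing Implicit Defensive.
Import Order.TTheory GRing.Theory Num.Theory.
Import numFieldNormedType.Exports.

Local Open Scope classical_set_scope.
Local Open Scope ring_scope.

(* The Borel sigma-algebra of R^n is presented as the product sigma-algebra,
   generated by the coordinate functions; the library has it on tuples only. *)
Definition measure_rV_display : measure_display -> measure_display.
Proof. exact. Qed.

Section measurable_rV.
Context {d} {T : measurableType d} (n : nat).

Let coord : 'I_n -> 'rV[T]_n -> T := fun i x => x ord0 i.

Let rV_set0 : g_sigma_preimage coord set0.
Proof. exact: sigma_algebra0. Qed.

Let rV_setC A : g_sigma_preimage coord A -> g_sigma_preimage coord (~` A).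
Proof. exact: sigma_algebraC. Qed.

Let rV_bigcup (F : (set 'rV[T]_n)^nat) :
  (forall i, g_sigma_preimage coord (F i)) ->
  g_sigma_preimage coord (\bigcup_i (F i)).
Proof. exact: sigma_algebra_bigcup. Qed.

HB.instance Definition _ := @isMeasurable.Build (measure_rV_display d)
  'rV[T]_n (g_sigma_preimage coord) rV_set0 rV_setC rV_bigcup.

End measurable_rV.

Lemma measurable_coord d (T : measurableType d) n (i : 'I_n) :
  measurable_fun setT (fun x : 'rV[T]_n => x ord0 i).
Proof.
move=> _ Y mY; rewrite setTI; apply: sub_sigma_algebra => /=.
rewrite -bigcup_seq/=; exists i => /=; first by rewrite mem_index_enum.
by exists Y => //; rewrite setTI.
Qed.

Lemma measurable_fun_rVP d1 d2 (T1 : measurableType d1)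
    (T2 : measurableType d2) n (f : T1 -> 'rV[T2]_n) :
  (forall i, measurable_fun setT (fun x => f x ord0 i)) ->
  measurable_fun setT f.
Proof.
move=> mf.
have : g_sigma_preimage (fun i x => f x ord0 i) `<=` measurable.
  apply: smallest_sub; first exact: sigma_algebra_measurable.
  move=> A; rewrite -bigcup_seq/= => -[i _ [B mB <-]]; exact: mf.
rewrite (_ : (fun i x => f x ord0 i) =
    (fun i => (fun y : 'rV[T2]_n => y ord0 i) \o f)) //.
rewrite g_sigma_preimage_comp => prefS _ A mA.
by apply: prefS; exists A.
Qed.

Section lebesgue_rV.
Context {R : realType}.
Local Open Scope ereal_scope.

Definition rV_cons n (p : R * 'rV[R]_n) : 'rV[R]_n.+1 :=
  \row_i oapp (p.2 ord0) p.1 (unlift ord0 i).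

Definition rV_uncons n (x : 'rV[R]_n.+1) : R * 'rV[R]_n :=
  (x ord0 ord0, \row_j x ord0 (lift ord0 j)).

Lemma rV_cons0 n (p : R * 'rV[R]_n) : rV_cons p ord0 ord0 = p.1.
Proof. by rewrite mxE unlift_none. Qed.

Lemma rV_consS n (p : R * 'rV[R]_n) j :
  rV_cons p ord0 (lift ord0 j) = p.2 ord0 j.
Proof. by rewrite mxE liftK. Qed.

Lemma rV_consK n : cancel (@rV_cons n) (@rV_uncons n).
Proof.
move=> p; rewrite /rV_uncons rV_cons0 [RHS]surjective_pairing; congr pair.
by apply/rowP => j; rewrite mxE rV_consS.
Qed.

Lemma measurable_rV_cons n : measurable_fun setT (@rV_cons n).
Proof.
apply: measurable_fun_rVP => i.
have [j ->|->] := unliftP ord0 i.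
  by under eq_fun do rewrite rV_consS;
    exact: (measurableT_comp (measurable_coord j) measurable_snd).
by under eq_fun do rewrite rV_cons0; exact: measurable_fst.
Qed.

Lemma measurable_rV_uncons n : measurable_fun setT (@rV_uncons n).
Proof.
apply/measurable_fun_pairP; split => /=; first exact: measurable_coord.
apply: measurable_fun_rVP => j /=.
rewrite (_ : (fun x => _) = (fun x : 'rV[R]_n.+1 => x ord0 (lift ord0 j))).
  exact: measurable_coord.
by apply/funext => x; rewrite /= mxE.
Qed.

Section step.
Context n (mu : {sigma_finite_measure set 'rV[R]_n -> \bar R}).

Definition lebesgue_step : set 'rV[R]_n.+1 -> \bar R :=
  pushforward (@lebesgue_measure R \x mu) (@rV_cons n).

Let step_measure : {measure set 'rV[R]_n.+1 -> \bar R} :=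
  measure_function_pushforward__canonical__measure_function_Measure
    (@lebesgue_measure R \x mu) (@measurable_rV_cons n).

Let step0 : lebesgue_step set0 = 0.
Proof. exact: (measure0 step_measure). Qed.

Let step_ge0 A : 0 <= lebesgue_step A.
Proof. exact: (measure_ge0 step_measure). Qed.

Let step_sigma_additive : semi_sigma_additive lebesgue_step.
Proof. exact: (@measure_semi_sigma_additive _ _ _ step_measure). Qed.

HB.instance Definition _ := isMeasure.Build _ _ _ lebesgue_step
  step0 step_ge0 step_sigma_additive.

Let step_sigma_finite : sigma_finite setT lebesgue_step.
Proof.
have /sigma_finiteP[F [TF ndF Foo]] := sigma_finiteT (@lebesgue_measure R).
have /sigma_finiteP[G [TG ndG Goo]] := sigma_finiteT mu.
exists (fun k => @rV_uncons n @^-1` (F k `*` G k)).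
  apply/esym/seteqP; split => // x _.
  have [k _ Fk] : (\bigcup_k F k) (x ord0 ord0) by rewrite -TF.
  have [l _ Gl] : (\bigcup_k G k) (rV_uncons x).2 by rewrite -TG.
  exists (maxn k l) => //; split.
  - by have /subsetPset FS := ndF _ _ (leq_maxl k l); exact: FS.
  - by have /subsetPset GS := ndG _ _ (leq_maxr k l); exact: GS.
move=> k; have [mF Fkoo] := Foo k; have [mG Gkoo] := Goo k; split.
  rewrite -[X in measurable X]setTI; apply: measurable_rV_uncons => //.
  exact: measurableX.
rewrite /lebesgue_step /pushforward -comp_preimage.
rewrite (_ : _ \o _ = id); last by apply/funext => p; exact: rV_consK.
by rewrite preimage_id product_measure1E// lte_mul_pinfty// ge0_fin_numE.
Qed.

HB.instance Definition _ := Measure_isSigmaFinite.Build _ _ _ lebesgue_step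
  step_sigma_finite.

End step.

(* Lebesgue measure on Borel sets, as the n-fold product of the
   one-dimensional Lebesgue measure. *)
Fixpoint borel_lebesgue n : {sigma_finite_measure set 'rV[R]_n -> \bar R} :=
  match n with
  | 0 => dirac (0%R : 'rV[R]_0)
  | n'.+1 => lebesgue_step (borel_lebesgue n')
  end.

End lebesgue_rV.

(* R^n with the Lebesgue-measurable sets, i.e. the sets that are Caratheodory
   measurable for the outer measure induced by borel_lebesgue; the carrier is
   'rV[R]_n. *)
Definition lebesgue_space (R : realType) (n : nat) :=
  caratheodory_type (@borel_lebesgue R n)^*%mu.

HB.instance Definition _ (R : realType) (n : nat) :=
  Measurable.on (lebesgue_space R n).

Section lebesgue_completed.
Context (R : realType) (n : nat).

Definition lebesgue : set (lebesgue_space R n) -> \bar R :=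
  @completed_measure_extension _ _ _ (@borel_lebesgue R n).

HB.instance Definition _ := Measure.on lebesgue.

HB.instance Definition _ := @Measure_isSigmaFinite.Build _ _ _ lebesgue
  (completed_measure_extension_sigma_finite
    (sigma_finiteT (@borel_lebesgue R n))).

End lebesgue_completed.

Section central_means.
Context {R : realType}.
Local Open Scope ereal_scope.

(* Power of x in [0, +oo] with a real exponent. The library's poweR differs
   for p < 0, where 0 `^ p = 0 and +oo `^ p = +oo; here these are +oo and 0. *)
Definition epow (x : \bar R) (p : R) : \bar R :=
  if (0 <= p)%R then poweR x p else (poweR x (- p))^-1.

(* The library's norm on 'rV[R]_n is the sup norm. *)
Definition enorm n (x : 'rV[R]_n) : R := Num.sqrt (\sum_i x ord0 i ^+ 2).

Definition eball n (rho : R) : set (lebesgue_space R n) :=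
  [set x | (enorm x < rho)%R].
Arguments eball : clear implicits.

Definition vball n (rho : R) : \bar R := lebesgue (eball n rho).
Arguments vball : clear implicits.

Definition Lloc n (r w : R) (f : 'rV[R]_n -> R) : Prop :=
  forall K : set 'rV[R]_n, compact K ->
    \int[@lebesgue R n]_(x in K)
      (epow `|f x|%:E r * epow (enorm x)%:E w) < +oo.

Definition central_mean n (r alpha : R) (f : 'rV[R]_n -> R)
    (rho : R) : \bar R :=
  epow ((epow (vball n rho) alpha)^-1 *
    \int[@lebesgue R n]_(x in eball n rho)
      (epow (vball n (enorm x)) (alpha - 1) * epow `|f x|%:E r)) r^-1.

Definition companion_mean n (r alpha : R) (f : 'rV[R]_n -> R)
    (rho : R) : \bar R :=
  epow ((epow (vball n rho) alpha)^-1 *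
    \int[@lebesgue R n]_(x in ~` eball n rho)
      (epow (vball n (enorm x)) (alpha - 1) * epow `|f x|%:E r)) r^-1.

End central_means.

(* Main.v *)
(* Write V(y) for the volume of the ball of radius |y|, p = s/r and
   b = alpha - gamma/p.  Since p > 1 or p < 0, t^p is convex.  On the domain of
   integration D_y attached to y (the ball if b > 0, its complement if b < 0)
   the density |b| V(y)^(-b) V(x)^(b-1) is a probability density, so Jensen's
   inequality for |f|^r V^(gamma/p) bounds the p-th power of the mean by an
   integral of |f|^s.  By Tonelli's theorem it remains to integrate
   |b| V(y)^(-b-1) over the y such that x is in D_y, which gives exactly
   V(x)^(-b); hence the sharp constant.  Both normalizations are
   one-dimensional integrals of powers, because V maps the Lebesgue measure of
   R^n to that of the half-line: |{V < c}| = c.  With the conventions of epow,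
   Jensen's inequality holds for all [0, +oo]-valued functions. *)
Require Import Defs.
From mathcomp Require Import all_boot all_order all_algebra.
From mathcomp Require Import all_classical all_reals all_analysis.
From mathcomp Require Import measurable_realfun ring lra.
Import Order.TTheory GRing.Theory Num.Theory.
Import numFieldNormedType.Exports.
Local Open Scope classical_set_scope.
Local Open Scope ring_scope.

(** * Powers with values in [0, +oo] *)

Section extended_powers.
Context {R : realType}.
Implicit Types (x y : \bar R) (c p q : R).
Local Open Scope ereal_scope.

Lemma epow_ge0 x p : 0 <= x -> 0 <= epow x p.
Proof.
by move=> x0; rewrite /epow; case: ifPn => _; rewrite ?inve_ge0 poweR_ge0.
Qed.

Lemma epow_EFin c p : (0 < c)%R -> epow c%:E p = (c `^ p)%:E.
Proof.
move=> c0; rewrite /epow; case: ifPn => // _.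
by rewrite poweR_EFin inver gt_eqF ?powR_gt0// powRN invrK.
Qed.

Lemma epow0 p : p != 0%R -> epow 0 p = if (0 < p)%R then 0 else +oo.
Proof.
move=> p0; rewrite /epow le_eqVlt [0%R == p]eq_sym (negbTE p0) orFb.
by case: ifPn => _; rewrite poweR0r ?inve0 ?oppr_eq0.
Qed.

Lemma epowy p : p != 0%R -> epow +oo p = if (0 < p)%R then +oo else 0.
Proof.
move=> p0; rewrite /epow le_eqVlt [0%R == p]eq_sym (negbTE p0) orFb.
by case: ifPn => _; rewrite poweRyr ?invey ?oppr_eq0.
Qed.

(** At 0 and +oo only signs matter: a negative exponent exchanges these two values, and the sign of
    [p * q] tells whether the composite does. *)
Lemma epow_epow x p q : 0 <= x -> p != 0%R -> q != 0%R ->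
  epow (epow x p) q = epow x (p * q).
Proof.
move=> x0 p0 q0; have pq0 : (p * q != 0)%R by rewrite mulf_neq0.
have pq : (0 < p * q)%R = ((0 < p) == (0 < q))%R.
  move: p0 q0; rewrite !neq_lt => /orP[p0|p0] /orP[q0|q0].
  - by rewrite nmulr_rgt0// q0 !ltNge !ltW.
  - by rewrite nmulr_rgt0// q0 !ltNge (ltW p0) (ltW q0).
  - by rewrite pmulr_rgt0// p0 !ltNge (ltW q0).
  - by rewrite pmulr_rgt0// p0 q0.
case: x x0 => [c| |//]; last first.
  move=> _; rewrite !epowy// pq.
  by case: (ltP 0%R p) => _; rewrite ?epowy ?epow0//; case: ifP.
rewrite lee_fin le_eqVlt => /predU1P[<-|c0].
  rewrite !epow0// pq.
  by case: (ltP 0%R p) => _; rewrite ?epowy ?epow0//; case: ifP.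
by rewrite !epow_EFin ?powR_gt0// powRrM.
Qed.

(** A positive finite factor never produces the product of 0 and +oo, so homogeneity extends to x =
    0 and x = +oo for exponents of either sign. *)
Lemma epowZ c x p : (0 < c)%R -> 0 <= x ->
  epow (c%:E * x) p = (c `^ p)%:E * epow x p.
Proof.
move=> c0; have [->|p0] := eqVneq p 0%R.
  by rewrite /epow lexx !poweRe0 powRr0 mul1e.
have cp0 : (0 < (c `^ p)%:E) by rewrite lte_fin powR_gt0.
case: x => [a| |//]; last first.
  by move=> _; rewrite gt0_muley ?lte_fin// epowy//;
    case: ifP; rewrite ?mule0 ?gt0_muley.
rewrite lee_fin le_eqVlt => /predU1P[<-|a0].
  by rewrite mule0 epow0//; case: ifP; rewrite ?mule0 ?gt0_muley.
by rewrite -EFinM !epow_EFin ?mulr_gt0// powRM// ltW.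
Qed.

Lemma inve_epow x p : 0 <= x -> (epow x p)^-1 = epow x (- p).
Proof.
move=> x0; have [->|p0] := eqVneq p 0%R.
  by rewrite oppr0 /epow lexx poweRe0 inver oner_eq0 invr1.
rewrite /epow oppr_ge0; case: (ltrgt0P p) p0 => // p0 _; first by rewrite opprK.
by rewrite inveK.
Qed.

Lemma measurable_epow p : measurable_fun [set: \bar R] (epow ^~ p).
Proof.
rewrite /epow; have [p0|p0] := leP 0%R p; first exact: measurable_poweR.
have Np0 : (- p == 0)%R = false by rewrite oppr_eq0 lt_eqF.
(* For p < 0 this is a real power apart from three exceptional points; the value +oo at -oo is
   merely the default inherited from [poweR]. *)
rewrite (_ : (fun _ => _) = fun x => if (x == 0) || (x == -oo) then +oo else
    if x == +oo then 0 else (fine x `^ p)%:E); last first.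
  apply/funext => -[a| |]; rewrite ?orbT.
  - rewrite orbF poweR_EFin inver powRN invr_eq0 powR_eq0 (lt_eqF p0) andbT.
    rewrite invrK.
    by rewrite eqe.
  - by rewrite poweRyr ?Np0// invey.
  - by rewrite poweRNyr ?Np0// inve0.
have meq (A : set \bar R) : measurable A ->
    measurable_fun [set: \bar R] (fun x => x \in A).
  move=> mA; apply: (measurable_fun_bool true); rewrite setTI.
  rewrite (_ : _ @^-1` _ = A)//; apply/seteqP; split => x /=.
    by move/set_mem.
  by move/mem_set.
under eq_fun => x.
  rewrite (_ : (x == 0) || (x == -oo) = (x \in [set 0; -oo])); last first.
    by apply/idP/idP => [/orP[/eqP->|/eqP->]|]; rewrite inE/=;
      [left|right|case=> ->; rewrite eqxx ?orbT].
  rewrite (_ : (x == +oo) = (x \in [set +oo])); last first.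
    by apply/idP/idP => [/eqP->|]; rewrite inE/= => // ->.
  over.
apply: measurable_fun_ifT => //; first exact/meq/measurableU.
apply: measurable_fun_ifT => //; first exact: meq.
apply/measurable_EFinP.
apply: (@measurableT_comp _ _ _ _ _ _ (@powR R ^~ p)) => //.
Qed.

End extended_powers.

(** * Jensen's inequality *)

Section jensen.
Context {R : realType}.
Local Open Scope ereal_scope.

(** Young's inequality in disguise: it is applied to t and 1 with exponents p and p/(p-1) if p > 1,
    and to two reciprocal powers of t if p < 0. *)
Lemma bernoulli_powR (p t : R) : (1 < p \/ p < 0)%R -> (0 < t)%R ->
  (1 + p * (t - 1) <= t `^ p)%R.
Proof.
move=> + t0; have t0' := ltW t0; case=> [p1|p0].
  have p0 : (0 < p)%R by rewrite (lt_trans _ p1).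
  have := @conjugate_powR _ t 1%R p (1 - p^-1)^-1%R t0' ler01 p0.
  rewrite invr_gt0 subr_gt0 invf_lt1// p1 invrK addrC subrK => /(_ isT erefl).
  rewrite mulr1 powR1 mul1r -(ler_pM2l p0) mulrDr mulrCA divff ?gt_eqF// mulr1.
  by rewrite mulrBr divff ?gt_eqF// mulr1 mulrBr mulr1 => h; lra.
have q0 : (0 < 1 - p)%R by rewrite subr_gt0 (lt_trans p0).
have qN0 : (1 - p != 0)%R by rewrite gt_eqF.
have pN0 : (p != 0)%R by rewrite lt_eqF.
(* The two factors have product 1, and the exponents 1-p and (1-p)/(-p) turn them into t^p and t. *)
have := @conjugate_powR _ (t `^ (p / (1 - p)))%R (t `^ (- p / (1 - p)))%R
  (1 - p)%R ((1 - p) / - p)%R (powR_ge0 _ _) (powR_ge0 _ _) q0.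
rewrite divr_gt0 ?oppr_gt0// => /(_ isT).
have -> : ((1 - p)^-1 + ((1 - p) / - p)^-1 = 1)%R.
  by field; rewrite ?pN0 ?qN0.
move=> /(_ erefl); rewrite -!powRrM -powRD; last by rewrite (gt_eqF t0) implybT.
have -> : (p / (1 - p) + - p / (1 - p) = 0)%R by field.
have -> : (p / (1 - p) * (1 - p) = p)%R by field.
have -> : (- p / (1 - p) * ((1 - p) / - p) = 1)%R by field; rewrite ?pN0 ?qN0.
rewrite powRr0 powRr1// -(ler_pM2l q0) mulr1 mulrDr mulrCA divff// mulr1.
have -> : ((1 - p) * (t / ((1 - p) / - p)) = - p * t)%R.
  by field; rewrite ?pN0 ?qN0.
by move=> h; lra.
Qed.

Lemma invr_powR (p c : R) : (0 < c)%R -> (c^-1 `^ p = (c `^ p)^-1)%R.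
Proof.
by move=> /ltW c0; rewrite -powR_inv1// -powRrM mulN1r powRN.
Qed.

(* The tangent line of t^p at c lies below the graph; the two sides are
   arranged so that every coefficient is nonnegative. *)
Lemma epow_tangent_gt1 (p c : R) (x : \bar R) : (1 < p)%R -> (0 < c)%R ->
  0 <= x ->
  (p * c `^ (p - 1))%:E * x <= epow x p + ((p - 1) * c `^ p)%:E.
Proof.
move=> p1 c0; have p0 : (0 < p)%R by rewrite (lt_trans _ p1).
have pN0 : p != 0%R by rewrite gt_eqF.
case: x => [x| |//]; last first.
  by move=> _; rewrite epowy// p0 addye// leey.
rewrite lee_fin le_eqVlt => /predU1P[<-|x0].
  rewrite mule0 epow0// p0 add0e lee_fin mulr_ge0 ?powR_ge0//.
  by rewrite subr_ge0 ltW.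
rewrite epow_EFin// -EFinM -EFinD lee_fin.
have := @bernoulli_powR p (x / c)%R (or_introl p1) (divr_gt0 x0 c0).
rewrite powRM ?invr_ge0 ?(ltW x0) ?(ltW c0)// invr_powR//.
have cp0 := powR_gt0 p c0.
rewrite ler_pdivlMr//.
have -> : (c `^ (p - 1) = c `^ p / c)%R.
  by rewrite powRD ?(gt_eqF c0) ?implybT// powR_inv1// ltW.
move=> h.
have -> : (p * (c `^ p / c) * x = p * (x / c) * c `^ p)%R by ring.
by lra.
Qed.

Lemma epow_tangent_lt0 (p c : R) (x : \bar R) : (p < 0)%R -> (0 < c)%R ->
  0 <= x ->
  ((1 - p) * c `^ p)%:E <= epow x p + (- p * c `^ (p - 1))%:E * x.
Proof.
move=> p0 c0; have pN0 : p != 0%R by rewrite lt_eqF.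
have pc0 : (0 < - p * c `^ (p - 1))%R by rewrite mulr_gt0 ?powR_gt0 ?oppr_gt0.
case: x => [x| |//]; last first.
  by move=> _; rewrite epowy// (lt_gtF p0) gt0_muley ?lte_fin// add0e leey.
rewrite lee_fin le_eqVlt => /predU1P[<-|x0].
  by rewrite mule0 epow0// (lt_gtF p0) adde0 leey.
rewrite epow_EFin// -EFinM -EFinD lee_fin.
have := @bernoulli_powR p (x / c)%R (or_intror p0) (divr_gt0 x0 c0).
rewrite powRM ?invr_ge0 ?(ltW x0) ?(ltW c0)// invr_powR//.
have cp0 := powR_gt0 p c0.
rewrite ler_pdivlMr//.
have -> : (c `^ (p - 1) = c `^ p / c)%R.
  by rewrite powRD ?(gt_eqF c0) ?implybT// powR_inv1// ltW.
move=> h.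
have -> : (- p * (c `^ p / c) * x = - p * (x / c) * c `^ p)%R by ring.
by lra.
Qed.

Context d (T : measurableType d) (mu : {measure set T -> \bar R}).

(** The tangent inequality at each c > 0 is integrated against the probability density [w]; taking
    the mean for c gives the claim when the mean is positive and finite. The means 0 and +oo are
    treated separately. *)
Lemma jensen_epow (D : set T) (w : T -> R) (h : T -> \bar R) (p : R) :
  measurable D -> measurable_fun D w -> measurable_fun D h ->
  (forall x, D x -> (0 <= w x)%R) -> (forall x, D x -> 0 <= h x) ->
  \int[mu]_(x in D) (w x)%:E = 1 -> (1 < p \/ p < 0)%R ->
  epow (\int[mu]_(x in D) ((w x)%:E * h x)) p <=
  \int[mu]_(x in D) ((w x)%:E * epow (h x) p).
Proof.
move=> mD mw mh w0 h0 w1.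
have mwE : measurable_fun D (fun x => (w x)%:E) by exact/measurable_EFinP.
have w0E x : D x -> 0 <= (w x)%:E by move=> Dx; rewrite lee_fin w0.
have mhp : measurable_fun D (fun x => epow (h x) p).
  exact: (measurableT_comp (measurable_epow p)).
have hp0 x : D x -> 0 <= epow (h x) p by move=> Dx; rewrite epow_ge0// h0.
have mwh : measurable_fun D (fun x => (w x)%:E * h x).
  exact: emeasurable_funM.
have wh0 x : D x -> 0 <= (w x)%:E * h x.
  by move=> Dx; rewrite mule_ge0 ?w0E ?h0.
have mwhp : measurable_fun D (fun x => (w x)%:E * epow (h x) p).
  exact: emeasurable_funM.
have whp0 x : D x -> 0 <= (w x)%:E * epow (h x) p.
  by move=> Dx; rewrite mule_ge0 ?w0E ?hp0.
set I := \int[mu]_(x in D) ((w x)%:E * h x).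
set J := \int[mu]_(x in D) ((w x)%:E * epow (h x) p).
have I0 : 0 <= I by exact: integral_ge0.
have J0 : 0 <= J by exact: integral_ge0.
have mscale (k : R) (u : T -> \bar R) : measurable_fun D u ->
    measurable_fun D (fun x => k%:E * u x).
  by move=> mu'; exact: measurable_funeM.
have scale_ge0 (k : R) (u : T -> \bar R) : (0 <= k)%R ->
    (forall x, D x -> 0 <= u x) -> forall x, D x -> 0 <= k%:E * u x.
  by move=> k0 u0 x Dx; rewrite mule_ge0 ?lee_fin// u0.
case=> [p1|p0].
  have p0 : (0 < p)%R by rewrite (lt_trans _ p1).
  have pN0 : p != 0%R by rewrite gt_eqF.
  have tangent (c : R) : (0 < c)%R ->
      (p * c `^ (p - 1))%:E * I <= J + ((p - 1) * c `^ p)%:E.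
    move=> c0.
    have a0 : (0 <= p * c `^ (p - 1))%R by rewrite mulr_ge0 ?powR_ge0// ltW.
    have b0 : (0 <= (p - 1) * c `^ p)%R.
      by rewrite mulr_ge0 ?powR_ge0// subr_ge0 ltW.
    (* The constant term is multiplied by the integral of [w], which is 1, so that both sides become
       integrals and can be compared pointwise. *)
    rewrite -[X in J + X]mule1 -w1 -!ge0_integralZl// -ge0_integralD//;
      [|exact: scale_ge0|exact: mscale].
    apply: ge0_le_integral => //.
    - exact: scale_ge0.
    - exact: mscale.
    - by apply: emeasurable_funD => //; exact: mscale.
    - move=> x Dx; rewrite muleCA [X in _ + X]muleC -ge0_muleDr ?hp0 ?lee_fin//.
      by rewrite lee_wpmul2l ?w0E// epow_tangent_gt1// h0.
  (* If I = +oo, the tangent at c = 1 already forces J = +oo. *)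
  clearbody I J; case: I I0 tangent => [c| |//]; last first.
    move=> _ /(_ 1%R ltr01); rewrite powR1 !mulr1 gt0_muley ?lte_fin//.
    by case: J J0 => [j| |//] _; rewrite ?leey// -EFinD leye_eq.
  rewrite lee_fin le_eqVlt => /predU1P[<- _|c0]; first by rewrite epow0// p0.
  move=> /(_ c c0); rewrite epow_EFin//.
  rewrite -EFinM -mulrA [X in (_ * X)%R]mulrC mulr_powRB1//; last exact: ltW.
  case: J J0 => [j| |//] _; rewrite ?leey// -EFinD !lee_fin => tg; lra.
have pN0 : p != 0%R by rewrite lt_eqF.
have tangent (c : R) : (0 < c)%R ->
    ((1 - p) * c `^ p)%:E <= J + (- p * c `^ (p - 1))%:E * I.
  move=> c0.
  have a0 : (0 <= - p * c `^ (p - 1))%R.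
    by rewrite mulr_ge0 ?powR_ge0// oppr_ge0 ltW.
  have b0 : (0 <= (1 - p) * c `^ p)%R.
    by rewrite mulr_ge0 ?powR_ge0// subr_ge0 ltW// (lt_trans p0).
  rewrite -[X in X <= _]mule1 -w1 -!ge0_integralZl// -ge0_integralD//;
    [|exact: scale_ge0|exact: mscale].
  apply: ge0_le_integral => //.
  - exact: scale_ge0.
  - exact: mscale.
  - by apply: emeasurable_funD => //; exact: mscale.
  - move=> x Dx; rewrite muleCA muleC -ge0_muleDr ?hp0//; last first.
      by rewrite mule_ge0 ?lee_fin// h0.
    by rewrite lee_wpmul2l ?w0E// epow_tangent_lt0// h0.
clearbody I J; case: I I0 tangent => [c| |//]; last first.
  by move=> _ _; rewrite epowy// (lt_gtF p0).
rewrite lee_fin le_eqVlt => /predU1P[<-|c0].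
  (* Here I = 0 and I^p = +oo, so J must be infinite. If J = j were finite, the tangent at the point
     c with c^p = j + 1 would give (1-p)(j+1) <= j, which is impossible for p < 0. *)
  case: J J0 => [j| |//] j0; last by rewrite leey.
  move=> /(_ ((j + 1) `^ p^-1)%R); rewrite lee_fin in j0.
  have j1 : (0 < j + 1)%R by rewrite ltr_wpDl.
  rewrite powR_gt0// => /(_ isT); rewrite mule0 adde0 lee_fin -powRrM mulVf//.
  rewrite powRr1 ?(ltW j1)// => tg; exfalso; clear -p0 j0 tg; nra.
move=> /(_ c c0); rewrite epow_EFin//.
rewrite -EFinM -mulrA [(_ * c)%R]mulrC.
have -> : (c * c `^ (p - 1) = c `^ p)%R.
  rewrite powRD ?(gt_eqF c0) ?implybT// powR_inv1 ?ltW// mulrCA.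
  by rewrite divff ?gt_eqF// mulr1.
case: J J0 => [j| |//] _; rewrite ?leey// -EFinD !lee_fin => tg; lra.
Qed.

End jensen.

(** * Hardy's inequality for sections *)

Section tonelli_sections.
Context {R : realType} d1 d2 (T1 : measurableType d1) (T2 : measurableType d2).
Context (m1 : {sigma_finite_measure set T1 -> \bar R}).
Context (m2 : {sigma_finite_measure set T2 -> \bar R}).
Variables (E : set (T1 * T2)) (F : T1 * T2 -> \bar R).
Hypotheses (mE : measurable E) (mF : measurable_fun setT F).
Hypothesis F0 : forall z, (0 <= F z)%E.
Local Open Scope ereal_scope.

Let mFE : measurable_fun setT (F \_ E).
Proof. by apply/(measurable_restrictT _ mE); exact: measurable_funTS. Qed.

Let FE0 z : 0 <= (F \_ E) z.
Proof. by rewrite patchE; case: ifP. Qed.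

Let integral_ysectionE y :
  \int[m1]_(x in ysection E y) F (x, y) = fubini_G m1 (F \_ E) y.
Proof.
rewrite integral_mkcond; apply: eq_integral => x _.
by rewrite !patchE mem_ysection.
Qed.

Let integral_xsectionE x :
  \int[m2]_(y in xsection E x) F (x, y) = fubini_F m2 (F \_ E) x.
Proof.
rewrite integral_mkcond; apply: eq_integral => y _.
by rewrite !patchE mem_xsection.
Qed.

Lemma measurable_integral_ysection :
  measurable_fun setT (fun y => \int[m1]_(x in ysection E y) F (x, y)).
Proof.
under eq_fun do rewrite integral_ysectionE.
exact: measurable_fun_fubini_tonelli_G.
Qed.

(** Extending F by zero outside E turns both iterated integrals over sections into those of one
    nonnegative measurable function, to which Tonelli's theorem applies. *)
Lemma tonelli_sections :
  \int[m2]_y \int[m1]_(x in ysection E y) F (x, y) =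
  \int[m1]_x \int[m2]_(y in xsection E x) F (x, y).
Proof.
under eq_integral do rewrite integral_ysectionE.
under [RHS]eq_integral do rewrite integral_xsectionE.
by rewrite -(fubini_tonelli _ mFE).
Qed.

End tonelli_sections.

Section hardy.
Context {R : realType} d (T : measurableType d).
Context (mu : {sigma_finite_measure set T -> \bar R}).
Variables (W : T -> R) (E : set (T * T)) (P : set T).
Hypotheses (mW : measurable_fun setT W) (mE : measurable E) (mP : measurable P).
Hypothesis W0 : forall x, P x -> (0 < W x)%R.
Hypothesis EP : forall x y, E (x, y) -> P x /\ P y.
Local Open Scope ereal_scope.

Let mWp p : measurable_fun setT (fun x => (W x `^ p)%:E).
Proof.
apply/measurable_EFinP.
exact: (@measurableT_comp _ _ _ _ _ _ (@powR R ^~ p)).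
Qed.

(* Jensen's inequality is applied on each section of [E] with the probability
   density [|b| W(y)^(-b) W(x)^(b-1)]; the second normalization makes the
   exchange of integrals lossless. *)
Lemma hardy_sections (alpha gamma p : R) (g : T -> \bar R) :
  let b := (alpha - gamma / p)%R in
  (1 < p \/ p < 0)%R -> b != 0%R ->
  measurable_fun setT g -> (forall x, 0 <= g x) ->
  (forall y, P y ->
    \int[mu]_(x in ysection E y) (`|b| * W x `^ (b - 1))%:E = (W y `^ b)%:E) ->
  (forall x, P x ->
    \int[mu]_(y in xsection E x) (`|b| * W y `^ (- b - 1))%:E
      = (W x `^ (- b))%:E) ->
  \int[mu]_(y in P) ((W y `^ (gamma - 1))%:E * epow ((W y `^ (- alpha))%:E *
      \int[mu]_(x in ysection E y) ((W x `^ (alpha - 1))%:E * g x)) p) <=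
  ((`|b| `^ p)^-1)%:E *
    \int[mu]_(y in P) ((W y `^ (gamma - 1))%:E * epow (g y) p).
Proof.
move=> b p1 b0 mg g0 H1 H2.
have pN0 : p != 0%R by case: p1 => [/(lt_trans ltr01)/gt_eqF->|/lt_eqF->].
have nb0 : (0 < `|b|)%R by rewrite normr_gt0.
have C0 : (0 < (`|b| `^ p)^-1)%R by rewrite invr_gt0 powR_gt0.
have mgp : measurable_fun setT (fun x => epow (g x) p).
  exact: (measurableT_comp (measurable_epow p)).
have gp0 x : 0 <= epow (g x) p by exact: epow_ge0.
have mEy y : measurable (ysection E y) by exact: measurable_ysection.
have mEx x : measurable (xsection E x) by exact: measurable_xsection.
have EyP y x : ysection E y x -> P x.
  by rewrite /ysection/= inE => /EP[].
(* After Jensen's inequality the kernel splits as A(x) B(y): only A contains g, and B is what the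
   second normalization integrates. *)
pose A x := (W x `^ (b - 1 + gamma))%:E * epow (g x) p.
have A0 x : 0 <= A x by rewrite mule_ge0 ?lee_fin ?powR_ge0.
have mA : measurable_fun setT A by exact: emeasurable_funM.
pose B y := (`|b| * W y `^ (- b - 1))%:E.
have B0 y : 0 <= B y by rewrite lee_fin mulr_ge0 ?powR_ge0.
have mB : measurable_fun setT B.
  by rewrite /B; under eq_fun do rewrite EFinM; exact: measurable_funeM.
pose F (z : T * T) := A z.1 * B z.2.
have F0 z : 0 <= F z by rewrite mule_ge0.
have mF : measurable_fun setT F.
  apply: emeasurable_funM; first exact: (measurableT_comp mA).
  exact: (measurableT_comp mB).
pose I y := \int[mu]_(x in ysection E y) ((W x `^ (alpha - 1))%:E * g x).
have I0 y : 0 <= I y.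
  by apply: integral_ge0 => x _; rewrite mule_ge0 ?lee_fin ?powR_ge0.
have mI : measurable_fun setT I.
  pose G (z : T * T) := (W z.1 `^ (alpha - 1))%:E * g z.1.
  apply: (@measurable_integral_ysection _ _ _ _ _ mu E G) => //.
    apply: (@measurableT_comp _ _ _ _ _ _
      (fun x => (W x `^ (alpha - 1))%:E * g x)) => //.
    exact: emeasurable_funM.
  by move=> z; rewrite mule_ge0 ?lee_fin ?powR_ge0.
pose J y := \int[mu]_(x in ysection E y) F (x, y).
have J0 y : 0 <= J y by exact: integral_ge0.
have mJ : measurable_fun setT J by exact: measurable_integral_ysection.
have pointwise y : P y ->
    (W y `^ (gamma - 1))%:E * epow ((W y `^ (- alpha))%:E * I y) p <=
    ((`|b| `^ p)^-1)%:E * J y.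
  move=> Py; have Wy := W0 _ Py; have Wy0 q := powR_gt0 q Wy.
  (* The density [w] has integral 1 by the first normalization. The factor W^(gamma/p) in [h]
     adjusts the exponent, as b - 1 + gamma/p = alpha - 1. *)
  pose w x := (`|b| * W y `^ (- b) * W x `^ (b - 1))%R.
  pose h x := (W x `^ (gamma / p))%:E * g x.
  have w0 x : (0 <= w x)%R by rewrite !mulr_ge0 ?powR_ge0.
  have mw : measurable_fun setT w.
    apply: measurable_funM; first exact: measurable_cst.
    by apply/measurable_EFinP; exact: mWp.
  have h0 x : 0 <= h x by rewrite mule_ge0 ?lee_fin ?powR_ge0.
  have mh : measurable_fun setT h by exact: emeasurable_funM.
  have w1 : \int[mu]_(x in ysection E y) (w x)%:E = 1.
    transitivity (\int[mu]_(x in ysection E y)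
        ((W y `^ (- b))%:E * (`|b| * W x `^ (b - 1))%:E)).
      by apply: eq_integral => x _; rewrite -EFinM /w; congr EFin; ring.
    rewrite ge0_integralZl_EFin ?ltW// ?H1//.
    - by rewrite -EFinM -powRD ?(gt_eqF Wy) ?implybT// addNr powRr0.
    - by move=> x _; rewrite lee_fin mulr_ge0 ?powR_ge0.
    - under eq_fun do rewrite EFinM.
      by apply: measurable_funTS; exact: measurable_funeM.
  have := @jensen_epow _ _ _ mu _ w h p (mEy y) (measurable_funTS mw)
    (measurable_funTS mh) (fun x _ => w0 x) (fun x _ => h0 x) w1 p1.
  have -> : \int[mu]_(x in ysection E y) ((w x)%:E * h x) =
      (`|b| * W y `^ (- b))%:E * I y.
    transitivity (\int[mu]_(x in ysection E y)
        ((`|b| * W y `^ (- b))%:E * ((W x `^ (alpha - 1))%:E * g x))).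
      apply: eq_integral => x; rewrite inE => /EyP/W0 Wx.
      rewrite /h !muleA -!EFinM; congr (_%:E * _).
      rewrite /w -[LHS]mulrA; congr (_ * _)%R.
      rewrite -powRD ?(gt_eqF Wx) ?implybT//.
      by congr powR; rewrite /b; ring.
    apply: ge0_integralZl_EFin; first exact: mEy.
    - by move=> x _; rewrite mule_ge0 ?lee_fin ?powR_ge0.
    - by apply: measurable_funTS; exact: emeasurable_funM.
    - by rewrite mulr_ge0 ?powR_ge0.
  (* W(y)^(-b) exceeds the power in B by one factor W(y), while W(x)^(gamma/p) raised to the power p
     contributes W(x)^gamma to A. *)
  have -> : \int[mu]_(x in ysection E y) ((w x)%:E * epow (h x) p) =
      (W y)%:E * J y.
    transitivity (\int[mu]_(x in ysection E y) ((W y)%:E * F (x, y))).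
      apply: eq_integral => x; rewrite inE => /EyP/W0 Wx.
      rewrite /h epowZ ?powR_gt0// -powRrM divfK// /F /A /B /= /w.
      rewrite [in RHS]muleAC !muleA -!EFinM; congr (_%:E * _).
      rewrite !powRD ?(gt_eqF Wx) ?(gt_eqF Wy) ?implybT//.
      rewrite !powR_inv1 ?(ltW Wx) ?(ltW Wy)//.
      by field; rewrite ?(gt_eqF Wx) ?(gt_eqF Wy).
    apply: ge0_integralZl_EFin; first exact: mEy.
    - by move=> x _; exact: F0.
    - by apply: measurable_funTS; exact: measurableT_comp.
    - exact: ltW.
  rewrite !epowZ ?mulr_gt0// => le_J.
  (* K is the factor that carries Jensen's inequality to the claim; the powers of W(y) match because
     -b p - 1 = -alpha p + gamma - 1. *)
  pose K := ((`|b| `^ p)^-1 / W y)%R.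
  have K0 : (0 < K)%R by rewrite divr_gt0.
  have -> : (W y `^ (gamma - 1))%:E * (((W y `^ (- alpha)) `^ p)%:E *
      epow (I y) p) = K%:E * (((`|b| * W y `^ (- b)) `^ p)%:E * epow (I y) p).
    rewrite !muleA -!EFinM; congr (_%:E * _).
    rewrite powRM ?powR_ge0// -!powRrM /K mulrACA mulVf ?gt_eqF ?powR_gt0//.
    rewrite mul1r.
    rewrite -powR_inv1 ?(ltW Wy)// -!powRD ?(gt_eqF Wy) ?implybT//; congr powR.
    by rewrite /b; field.
  have -> : ((`|b| `^ p)^-1)%:E * J y = K%:E * ((W y)%:E * J y).
    by rewrite muleA -EFinM /K divfK ?(gt_eqF Wy).
  by rewrite lee_wpmul2l// lee_fin ltW.
apply: (@le_trans _ _ (\int[mu]_(y in P) (((`|b| `^ p)^-1)%:E * J y))).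
  apply: ge0_le_integral => //.
  - move=> y _; rewrite mule_ge0 ?lee_fin ?powR_ge0// epow_ge0//.
    rewrite mule_ge0 ?lee_fin ?powR_ge0//; exact: I0.
  - apply: measurable_funTS; apply: emeasurable_funM; first exact: mWp.
    apply: (measurableT_comp (measurable_epow p)).
    by apply: emeasurable_funM; [exact: mWp|exact: mI].
  - by apply: measurable_funTS; exact: measurable_funeM.
rewrite ge0_integralZl_EFin ?(ltW C0)//; last exact: measurable_funTS.
rewrite lee_pmul2l ?lte_fin//.
(* The domain P is enlarged to the whole space for Tonelli's theorem; nothing is lost, since the
   sections of E over points outside P are empty. *)
apply: (@le_trans _ _ (\int[mu]_y J y)).
  by apply: ge0_subset_integral.
rewrite /J tonelli_sections// [leRHS]integral_mkcond.
rewrite le_eqVlt; apply/orP; left; apply/eqP; apply: eq_integral => x _.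
rewrite patchE; case: ifPn => [|nPx]; last first.
  rewrite (_ : xsection E x = set0) ?integral_set0//.
  apply/seteqP; split => // y; rewrite /xsection/= inE => /EP[Px _].
  by rewrite notin_setE in nPx.
rewrite inE => Px; have Wx := W0 _ Px.
rewrite /F/= ge0_integralZl//; last exact: measurable_funTS.
(* The second normalization replaces the integral of B by W(x)^(-b), and (b - 1 + gamma) - b = gamma
   - 1 restores the weight. *)
rewrite H2// /A muleAC -EFinM -powRD ?(gt_eqF Wx) ?implybT//.
by congr ((_ `^ _)%:E * _); ring.
Qed.

End hardy.

(** * Integrals of powers of a function with Lebesgue distribution *)

Section power_integrals.
Context {R : realType}.
Notation leb := (@lebesgue_measure R).
Implicit Types a b v x : R.

Lemma continuous_powR b x : 0 < x -> {for x, continuous (@powR R ^~ b)}.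
Proof.
move=> x0; apply/differentiable_continuous/derivable1_diffP.
by apply: derivable_powR; rewrite in_itv/= x0.
Qed.

Lemma measurable_powR_EFin k b (D : set R) :
  measurable_fun D (fun x : R => (k * x `^ b)%:E).
Proof.
apply: measurable_funTS; apply/measurable_EFinP.
by apply: measurable_funM => //; exact: measurable_powR.
Qed.

Lemma cvgy_powRN b : 0 < b -> x `^ (- b) @[x --> +oo] --> (0 : R).
Proof.
move=> b0.
apply/cvgrPdist_le => e e0; near=> x.
(* The inequality x^(-b) <= e holds as soon as x >= e^(-1/b). *)
have c0 : 0 < e `^ (- b^-1) by rewrite powR_gt0.
have cx : e `^ (- b^-1) <= x by near: x; exact: nbhs_pinfty_ge.
have x0 : 0 < x by exact: lt_le_trans cx.
rewrite sub0r normrN ger0_norm ?powR_ge0// powRN invf_ple ?posrE ?powR_gt0//.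
have := @ge0_ler_powR _ b (ltW b0) _ _ (ltW c0) (ltW x0) cx.
by rewrite -powRrM mulNr mulVf ?gt_eqF// powR_inv1// ltW.
Unshelve. all: end_near. Qed.

Lemma integral_powR_itvcy b v : 0 < b -> 0 < v ->
  (\int[leb]_(x in `[v, +oo[) (b * x `^ (- b - 1))%:E = (v `^ (- b))%:E)%E.
Proof.
move=> b0 v0.
have dF x : 0 < x -> is_derive x 1 (fun x => - (x `^ (- b)))
    (b * x `^ (- b - 1)).
  move=> x0; have := is_deriveN (is_derive1_powR (- b) x0).
  by rewrite mulNr opprK.
rewrite (@ge0_continuous_FTC2y _ _ (fun x => - (x `^ (- b))) v 0).
- by rewrite sub0e -EFinN opprK.
- by move=> x _; rewrite mulr_ge0 ?powR_ge0// ltW.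
- apply: continuous_in_subspaceT => x; rewrite inE/= in_itv/= andbT => vx.
  apply: cvgM; first exact: cvg_cst.
  exact/continuous_powR/(lt_le_trans v0).
- by rewrite -oppr0; apply: cvgN; exact: cvgy_powRN.
- by move=> x /(lt_trans v0)/dF[].
- apply: cvg_at_right_filter; apply: cvgN; exact: continuous_powR.
- move=> x; rewrite in_itv/= andbT => /(lt_trans v0) x0.
  by rewrite derive1E; apply: derive_val; exact: dF.
Qed.

Lemma integral_powR_itvcc b a v : 0 < a -> a < v ->
  (\int[leb]_(x in `[a, v]) (b * x `^ (b - 1))%:E = (v `^ b - a `^ b)%:E)%E.
Proof.
move=> a0 av; have v0 := lt_trans a0 av.
rewrite (@continuous_FTC2 _ _ (@powR R ^~ b) a v)// ?EFinB//.
- apply: continuous_in_subspaceT => x; rewrite inE/= in_itv/= => /andP[ax _].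
  apply: cvgM; first exact: cvg_cst.
  exact/continuous_powR/(lt_le_trans a0).
- split.
  + move=> x; rewrite in_itv/= => /andP[/(lt_trans a0) x0 _].
    by apply: derivable_powR; rewrite in_itv/= x0.
  + by apply: cvg_at_right_filter; exact: continuous_powR.
  + by apply: cvg_at_left_filter; exact: continuous_powR.
- move=> x; rewrite in_itv/= => /andP[/(lt_trans a0) x0 _].
  by apply: powR_derive1; rewrite in_itv/= x0.
Qed.

(** For b < 1 the integrand is unbounded near 0, so the fundamental theorem of calculus is used on
    [v/(n+2), v] and monotone convergence passes to the union. *)
Lemma integral_powR_itv0c b v : 0 < b -> 0 < v ->
  (\int[leb]_(x in `]0%R, v]) (b * x `^ (b - 1))%:E = (v `^ b)%:E)%E.
Proof.
move=> b0 v0.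
(* The denominator n + 2 keeps the left endpoint strictly below v already at n = 0. *)
pose F (n : nat) := `[v / n.+2%:R, v]%classic : set (measurableTypeR R).
have Fv n : v / n.+2%:R < v by rewrite ltr_pdivrMr// ltr_pMr// ltr1n.
have -> : `]0, v]%classic = \bigcup_n F n.
  apply/seteqP; split => x /=; last first.
    move=> [n _]; rewrite /F/= !in_itv/= => /andP[nx ->]; rewrite andbT.
    by rewrite (lt_le_trans _ nx)// divr_gt0.
  rewrite in_itv/= => /andP[x0 xv].
  exists (Num.truncn (v / x)) => //; rewrite /F/= in_itv/= xv andbT.
  rewrite ler_pdivrMr// mulrC -ler_pdivrMr//.
  rewrite (le_trans (ltW (truncnS_gt _)))// ler_nat.
  by rewrite leqW.
have F0 n x : F n x -> (0 <= (b * x `^ (b - 1))%:E)%E.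
  by move=> _; rewrite lee_fin mulr_ge0 ?powR_ge0// ltW.
have cvgF := @ge0_nondecreasing_set_cvg_integral _ _ _ F
  (fun x => (b * x `^ (b - 1))%:E) lebesgue_measure.
apply: (cvg_unique _ (cvgF _ _ _ F0)) => //.
- move=> m n mn; apply/subsetPset => x; rewrite /F/= !in_itv/= => /andP[mx ->].
  rewrite andbT (le_trans _ mx)// ler_pM2l// lef_pV2 ?posrE// ler_nat.
  by rewrite !ltnS.
- by move=> n; exact: measurable_itv.
- by move=> n; exact: measurable_powR_EFin.
rewrite /= [X in X @ _ --> _](_ : _ =
  fun n => (v `^ b - v `^ b * n.+2%:R `^ (- b))%:E); last first.
  apply/funext => n; rewrite integral_powR_itvcc ?divr_gt0//.
  by rewrite powRM ?invr_ge0 ?(ltW v0)// -powR_inv1// -powRrM mulN1r.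
apply: cvg_EFin; first exact: nearW.
rewrite -[X in _ --> X]subr0; apply: cvgB; first exact: cvg_cst.
rewrite -(mulr0 (v `^ b)); apply: cvgM; first exact: cvg_cst.
move/cvg_pinftyP : (cvgy_powRN _ b0); apply.
have := (@cvgr_idn R); rewrite -(cvg_shiftn 2).
by under eq_fun do rewrite addn2.
Qed.

End power_integrals.

(** * Transfer of integrals to the half-line *)

Section distribution.
Context {R : realType} d (T : measurableType d).
Context (mu : {measure set T -> \bar R}) (W : T -> R).
Hypothesis mW : measurable_fun setT (W : T -> measurableTypeR R).
Hypotheses (W_ge0 : forall x, 0 <= W x).
Hypothesis muW : forall v, 0 < v -> mu [set x | W x < v] = v%:E.
Local Open Scope ereal_scope.
Notation leb := (@lebesgue_measure R).

(** The image of [mu] under W and Lebesgue measure restricted to [0, +oo[ agree on the rays ]-oo,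
    v[, which are stable under intersection and generate the Borel sets; uniqueness of measures does
    the rest. *)
Lemma distribution_lebesgue (A : set (measurableTypeR R)) :
  measurable A -> A `<=` `]0%R, +oo[%classic -> mu (W @^-1` A) = leb A.
Proof.
move=> mA A0.
have m0y : measurable (`[0%R, +oo[%classic : set (measurableTypeR R)).
  exact: measurable_itv.
pose G := @RGenInftyO.G R.
have muWv v : mu (W @^-1` `]-oo, v[) = mrestr leb m0y `]-oo, v[%classic.
  rewrite /mrestr; have [v0|v0] := ltP 0%R v.
    have -> : W @^-1` `]-oo, v[ = [set x | (W x < v)%R].
      by apply/seteqP; split => x /=; rewrite in_itv.
    rewrite muW//; apply/esym.
    rewrite (_ : _ `&` _ = `[0%R, v[%classic).
      by rewrite lebesgue_measure_itv/= lte_fin v0 sube0.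
    apply/seteqP; split => x /=; rewrite !in_itv/= andbT; first by case=> -> ->.
    by move=> /andP[-> ->].
  rewrite (_ : _ @^-1` _ = set0) ?measure0; last first.
    apply/seteqP; split => x //=; rewrite in_itv/= => xv.
    by have := lt_le_trans xv v0; rewrite ltNge W_ge0.
  rewrite (_ : _ `&` _ = set0) ?measure0//.
  apply/seteqP; split => x //=; rewrite !in_itv/= andbT => -[xv x0].
  by have := lt_le_trans xv v0; rewrite ltNge x0.
transitivity (mrestr leb m0y A); last first.
  rewrite /mrestr; congr (leb _); apply/setIidl => x /A0/=.
  by rewrite !in_itv/= !andbT => /ltW.
pose nu : {measure set (measurableTypeR R) -> \bar R} :=
  measure_function_pushforward__canonical__measure_function_Measure mu mW.
pose leb0 : {measure set (measurableTypeR R) -> \bar R} := mrestr leb m0y.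
change (nu A = leb0 A).
apply: (@measure_unique _ R (measurableTypeR R) G
  (fun n => `]-oo, n%:R[%classic) _ _ _ _ nu leb0) => //.
- exact: RGenInftyO.measurableE.
- move=> _ _ [u ->] [v ->]; exists (Num.min u v).
  apply/seteqP; split => x /=; rewrite !in_itv/= lt_min; first by case=> -> ->.
  by move=> /andP[-> ->].
- by move=> n; exists n%:R.
- apply/seteqP; split => // x _; exists (Num.truncn `|x|).+1 => //=.
  by rewrite in_itv/= (le_lt_trans (ler_norm _))// truncnS_gt.
- by move=> _ [v ->]; exact: muWv.
- move=> n; change (mu (W @^-1` `]-oo, n%:R[%classic) < +oo).
  have -> : W @^-1` `]-oo, n%:R[ = [set x | W x < n%:R]%R.
    by apply/seteqP; split => x /=; rewrite in_itv.
  case: n => [|n]; last by rewrite muW ?ltry.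
  rewrite (_ : [set x | _] = set0) ?measure0//.
  by apply/seteqP; split => x //=; rewrite ltNge W_ge0.
Qed.

Lemma integral_distribution (D : set (measurableTypeR R)) (f : R -> \bar R) :
  measurable D -> D `<=` `]0%R, +oo[%classic -> measurable_fun D f ->
  (forall x, D x -> 0 <= f x) ->
  \int[mu]_(x in W @^-1` D) f (W x) = \int[leb]_(x in D) f x.
Proof.
move=> mD D0 mf f0.
pose nu : {measure set (measurableTypeR R) -> \bar R} :=
  measure_function_pushforward__canonical__measure_function_Measure mu mW.
transitivity (\int[nu]_(x in D) f x).
  rewrite -[LHS](@ge0_integral_pushforward _ _ _ _ _ _ mW)//.
  by move=> x; rewrite inE; exact: f0.
apply: eq_measure_integral => A mA AD.
by apply: distribution_lebesgue => //; exact: subset_trans D0.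
Qed.

(** S lies between {0 < W < v} and {0 < W <= v}, whose integrals transfer to ]0, v[ and ]0, v] and
    coincide, a point being null. It is thus irrelevant which part of {W = v} belongs to S. *)
Lemma integral_powR_sublevel (b v : R) (S : set T) : (0 < b)%R -> (0 < v)%R ->
  measurable S ->
  (forall x, (0 < W x < v)%R -> S x) -> (forall x, S x -> (0 < W x <= v)%R) ->
  \int[mu]_(x in S) (b * W x `^ (b - 1))%:E = (v `^ b)%:E.
Proof.
move=> b0 v0 mS vS Sv.
pose f (t : R) := (b * t `^ (b - 1))%:E.
have f0 t : 0 <= f t by rewrite lee_fin mulr_ge0 ?powR_ge0// ltW.
have mf D : measurable_fun D f by exact: measurable_powR_EFin.
have mfW D : measurable_fun D (f \o W).
  by apply: measurable_funTS; exact: measurableT_comp.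
have mWD (D : set (measurableTypeR R)) : measurable D -> measurable (W @^-1` D).
  by move=> mD; rewrite -[X in measurable X]setTI; apply: mW.
have mfE D : measurable_fun (D : set (measurableTypeR R)) f.
  exact: measurable_powR_EFin.
have sub0 : `]0%R, v]%classic `<=` `]0%R, +oo[%classic.
  by move=> x /=; rewrite !in_itv/= andbT => /andP[].
have sub0' : `]0%R, v[%classic `<=` `]0%R, +oo[%classic.
  by move=> x /=; rewrite !in_itv/= andbT => /andP[].
apply/eqP; rewrite eq_le; apply/andP; split.
  rewrite -(integral_powR_itv0c _ _ b0 v0).
  rewrite -(integral_distribution _ f (measurable_itv _) sub0 (mfE _)
    (fun t _ => f0 t)).
  apply: ge0_subset_integral => //.
  - by apply: mWD; exact: measurable_itv.
  - by move=> x _; exact: f0.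
rewrite -(integral_powR_itv0c _ _ b0 v0) -integral_itv_bndo_bndc//.
rewrite -(integral_distribution _ f (measurable_itv _) sub0' (mfE _)
  (fun t _ => f0 t)).
apply: ge0_subset_integral => //.
by apply: mWD; exact: measurable_itv.
Qed.

Lemma integral_powR_superlevel (b v : R) (S : set T) : (0 < b)%R -> (0 < v)%R ->
  measurable S ->
  (forall x, (v < W x)%R -> S x) -> (forall x, S x -> (v <= W x)%R) ->
  \int[mu]_(x in S) (b * W x `^ (- b - 1))%:E = (v `^ (- b))%:E.
Proof.
move=> b0 v0 mS vS Sv.
pose f (t : R) := (b * t `^ (- b - 1))%:E.
have f0 t : 0 <= f t by rewrite lee_fin mulr_ge0 ?powR_ge0// ltW.
have mf D : measurable_fun D f by exact: measurable_powR_EFin.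
have mfW D : measurable_fun D (f \o W).
  by apply: measurable_funTS; exact: measurableT_comp.
have mWD (D : set (measurableTypeR R)) : measurable D -> measurable (W @^-1` D).
  by move=> mD; rewrite -[X in measurable X]setTI; apply: mW.
have mfE D : measurable_fun (D : set (measurableTypeR R)) f.
  exact: measurable_powR_EFin.
have sub0 : `[v, +oo[%classic `<=` `]0%R, +oo[%classic.
  by move=> x /=; rewrite !in_itv/= !andbT; exact: lt_le_trans.
have sub0' : `]v, +oo[%classic `<=` `]0%R, +oo[%classic.
  by move=> x /=; rewrite !in_itv/= !andbT; exact: lt_trans.
apply/eqP; rewrite eq_le; apply/andP; split.
  rewrite -(integral_powR_itvcy _ _ b0 v0).
  rewrite -(integral_distribution _ f (measurable_itv _) sub0 (mfE _)
    (fun t _ => f0 t)).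
  apply: ge0_subset_integral => //.
  - by apply: mWD; exact: measurable_itv.
  - by move=> x _; exact: f0.
  - by move=> x /Sv; rewrite /= in_itv/= andbT.
rewrite -(integral_powR_itvcy _ _ b0 v0) -integral_itv_obnd_cbnd//.
rewrite -(integral_distribution _ f (measurable_itv _) sub0' (mfE _)
  (fun t _ => f0 t)).
apply: ge0_subset_integral => //.
- by apply: mWD; exact: measurable_itv.
- by move=> x /=; rewrite in_itv/= andbT; exact: vS.
Qed.

End distribution.

(** * Euclidean balls *)

Section euclidean_balls.
Context {R : realType}.
Notation leb := (@lebesgue_measure R).
Implicit Types n : nat.

Lemma enorm_ge0 n (x : 'rV[R]_n) : 0 <= enorm x.
Proof. exact: sqrtr_ge0. Qed.

Lemma measurable_enorm n : measurable_fun setT (fun x : 'rV[R]_n => enorm x).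
Proof.
apply: (@measurableT_comp _ _ _ _ _ _ (@Num.sqrt R)).
  by apply: continuous_measurable_fun => x; exact: sqrt_continuous.
apply: measurable_sum => i; apply: (measurable_funX 2).
exact: measurable_coord.
Qed.

Lemma measurable_enorm_lt n (rho : R) :
  measurable [set x : 'rV[R]_n | enorm x < rho].
Proof.
rewrite (_ : [set x | _] = (fun x => enorm x) @^-1` `]-oo, rho[%classic).
  by rewrite -[X in measurable X]setTI; apply: measurable_enorm.
by apply/seteqP; split => x /=; rewrite in_itv.
Qed.

Lemma measurable_enorm_eq n (rho : R) :
  measurable [set x : 'rV[R]_n | enorm x = rho].
Proof.
rewrite (_ : [set x | _] = (fun x => enorm x) @^-1` [set rho])//.
by rewrite -[X in measurable X]setTI; apply: measurable_enorm.
Qed.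

Lemma enorm_cons n (t : R) (y : 'rV[R]_n) :
  enorm (rV_cons (t, y)) = Num.sqrt (t ^+ 2 + enorm y ^+ 2).
Proof.
rewrite /enorm big_ord_recl rV_cons0 sqr_sqrtr; last first.
  by apply: sumr_ge0 => i _; exact: sqr_ge0.
by under eq_bigr do rewrite rV_consS.
Qed.

Lemma lebesgue_borelE n (A : set 'rV[R]_n) : measurable A ->
  lebesgue (A : set (lebesgue_space R n)) = borel_lebesgue n A.
Proof. by move=> mA; exact: measurable_mu_extE. Qed.

Lemma measurable_lebesgue_space n (A : set 'rV[R]_n) : measurable A ->
  measurable (A : set (lebesgue_space R n)).
Proof. exact: caratheodory_measurable_mu_ext. Qed.

Lemma borel_lebesgueS n (A : set 'rV[R]_n.+1) :
  borel_lebesgue n.+1 A = (leb \x borel_lebesgue n)%E (@rV_cons R n @^-1` A).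
Proof. by []. Qed.

(** A line in the direction of the first coordinate meets the sphere in at most two points, so all
    these sections are null, and so is the sphere. *)
Lemma borel_lebesgue_sphere n (rho : R) :
  borel_lebesgue n.+1 [set x : 'rV[R]_n.+1 | enorm x = rho] = 0%E.
Proof.
rewrite borel_lebesgueS.
rewrite (product_measure_unique
  (product_measure2E leb (borel_lebesgue n))); last first.
  rewrite -[X in measurable X]setTI; apply: measurable_rV_cons => //.
  exact: measurable_enorm_eq.
rewrite /= /product_measure2; apply: integral0_eq => y _ /=.
apply: countable_lebesgue_measure0.
pose q := Num.sqrt (rho ^+ 2 - enorm y ^+ 2).
apply: (@sub_countable _ _ _ [set q; - q]); last first.
  exact/finite_set_countable.
apply: subset_card_le => t; rewrite /ysection/= inE/= enorm_cons => trho.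
have {}trho : t ^+ 2 = rho ^+ 2 - enorm y ^+ 2.
  by rewrite -trho sqr_sqrtr ?addrK// addr_ge0 ?sqr_ge0.
have : t ^+ 2 == q ^+ 2 by rewrite sqr_sqrtr -trho ?sqr_ge0.
by rewrite eqf_sqr => /orP[/eqP ->|/eqP ->]; [left|right].
Qed.

(** By induction on the dimension: the ball is contained in the product of ]-rho, rho[ and the ball
    of the same radius in one dimension less. *)
Lemma borel_lebesgue_ball_fin n (rho : R) :
  (borel_lebesgue n [set x : 'rV[R]_n | (enorm x < rho)%R] < +oo)%E.
Proof.
elim: n => [|n IHn]; first by rewrite /= diracE ltry.
have mI : measurable (`]- rho, rho[%classic : set (measurableTypeR R)).
  exact: measurable_itv.
have mB := measurable_enorm_lt n rho.
apply: (@le_lt_trans _ _ ((leb \x borel_lebesgue n)%E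
  (`]- rho, rho[%classic `*` [set x : 'rV[R]_n | enorm x < rho]))).
  rewrite borel_lebesgueS; apply: le_measure; rewrite ?inE.
  - rewrite -[X in measurable X]setTI; apply: measurable_rV_cons => //.
    exact: measurable_enorm_lt.
  - exact: measurableX.
  move=> [t y] /=; rewrite enorm_cons => try.
  have rho0 : 0 < rho by rewrite (le_lt_trans _ try)// sqrtr_ge0.
  move: try; rewrite -{1}(ger0_norm (ltW rho0)) -sqrtr_sqr.
  rewrite ltr_sqrt ?exprn_gt0// => try.
  split => /=.
    rewrite in_itv/= -ltr_norml -(ltr_pXn2r (n:=2))// ?nnegrE ?(ltW rho0)//.
    by rewrite real_normK ?num_real// (le_lt_trans _ try)// lerDl sqr_ge0.
  rewrite -(ltr_pXn2r (n:=2))// ?nnegrE ?(ltW rho0) ?enorm_ge0//.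
  by rewrite (le_lt_trans _ try)// lerDr sqr_ge0.
rewrite product_measure1E// lte_mul_pinfty//.
by rewrite /= lebesgue_measure_itv/=; case: ifP.
Qed.

Lemma borel_lebesgue_setT n : borel_lebesgue n.+1 [set: 'rV[R]_n.+1] = +oo%E.
Proof.
have bS m : borel_lebesgue m.+1 [set: 'rV[R]_m.+1] =
    (+oo * borel_lebesgue m [set: 'rV[R]_m])%E.
  rewrite borel_lebesgueS preimage_setT -setXTT product_measure1E//.
  by rewrite -set_itvNyy /= lebesgue_measure_itv.
elim: n => [|n IHn]; last by rewrite bS IHn mulyy.
by rewrite bS/= diracE in_setT mule1.
Qed.

End euclidean_balls.

(** * Volume of balls as a function of the radius *)

Section ball_volume.
Context {R : realType} (n : nat).
Notation mu := (@lebesgue R n.+1).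
Notation V := (@vball R n.+1).
Implicit Types rho c : R.

Lemma measurable_eball rho : measurable (@eball R n.+1 rho).
Proof. exact: (measurable_lebesgue_space _ _ (measurable_enorm_lt _ rho)). Qed.

Lemma vball_fin_num rho : V rho \is a fin_num.
Proof.
rewrite ge0_fin_numE ?measure_ge0// /vball lebesgue_borelE.
  exact: borel_lebesgue_ball_fin.
exact: measurable_enorm_lt.
Qed.

Lemma le_vball rho rho' : rho <= rho' -> (V rho <= V rho')%E.
Proof.
move=> le_rho; apply: le_measure; rewrite ?inE; try exact: measurable_eball.
by move=> x /lt_le_trans; apply.
Qed.

Lemma lebesgue_sphere rho :
  mu [set x : lebesgue_space R n.+1 | enorm x = rho] = 0%E.
Proof.
rewrite lebesgue_borelE; first exact: borel_lebesgue_sphere.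
exact: measurable_enorm_eq.
Qed.

Lemma measurable_sphere rho :
  measurable [set x : lebesgue_space R n.+1 | enorm x = rho].
Proof. exact: (measurable_lebesgue_space _ _ (measurable_enorm_eq _ rho)). Qed.

(** Balls of integer radius exhaust a space of infinite measure, so continuity from below
    applies. *)
Lemma vball_unbounded c : exists rho, (c%:E <= V rho)%E.
Proof.
have cvgV : (mu \o (fun k => @eball R n.+1 k%:R)) k @[k --> \oo] -->
    mu (\bigcup_k @eball R n.+1 k%:R).
  apply: nondecreasing_cvg_mu.
  - by move=> k; exact: measurable_eball.
  - by apply: bigcup_measurable => k _; exact: measurable_eball.
  - move=> i j ij; apply/subsetPset => x /lt_le_trans; apply.
    by rewrite ler_nat.
rewrite (_ : \bigcup_k _ = setT) in cvgV; last first.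
  apply/seteqP; split => // x _; exists (Num.truncn (enorm x)).+1 => //=.
  exact: truncnS_gt.
rewrite lebesgue_borelE// borel_lebesgue_setT in cvgV.
move/cvgeyPge : cvgV => /(_ c)[k _ /(_ k (leqnn k)) h].
by exists k%:R.
Qed.

(* [rho] is the supremum of the radii with ball volume below [c]; spheres are
   null, so the volume is continuous in the radius and takes the value [c]. *)
Lemma vball_level c : 0 < c -> exists rho, V rho = c%:E /\
  forall x : 'rV[R]_n.+1, (V (enorm x) < c%:E)%E = (enorm x < rho).
Proof.
move=> c0; pose S := [set rho | (V rho < c%:E)%E].
have S0 : S 0.
  rewrite /S/= (_ : V 0 = 0%E) ?lte_fin//.
  rewrite /vball (_ : eball _ = set0) ?measure0//.
  by apply/seteqP; split => x //=; rewrite /eball/= ltNge enorm_ge0.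
have [M cM] := vball_unbounded c.
have SM : ubound S M.
  move=> rho; apply: contraPle => /ltW/le_vball h.
  by rewrite /S/= ltNge (le_trans cM).
have hS : has_sup S by split; [exists 0|exists M].
pose rho := sup S.
have below t : t < rho -> (V t < c%:E)%E.
  move=> /(sup_gt (ex_intro _ 0 S0))[u Su tu].
  exact: le_lt_trans (le_vball _ _ (ltW tu)) Su.
have above t : rho < t -> (c%:E <= V t)%E.
  move=> rt; rewrite leNgt; apply/negP => Vt.
  by move: rt; rewrite ltNge => /negP; apply; apply: ub_le_sup; [exists M|].
have Vrho : V rho = c%:E.
  apply/eqP; rewrite eq_le; apply/andP; split.
    (* Upper bound: the ball of radius rho is the increasing union of the balls of radius rho -
       1/(k+1), all of volume below c. *)
    have cvgV : (mu \o (fun k => @eball R n.+1 (rho - k.+1%:R^-1))) k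
        @[k --> \oo] --> mu (\bigcup_k @eball R n.+1 (rho - k.+1%:R^-1)).
      apply: nondecreasing_cvg_mu.
      - by move=> k; exact: measurable_eball.
      - by apply: bigcup_measurable => k _; exact: measurable_eball.
      - move=> i j ij; apply/subsetPset => x /lt_le_trans; apply.
        by rewrite lerD2l lerN2 lef_pV2 ?posrE// ler_nat ltnS.
    rewrite (_ : \bigcup_k _ = @eball R n.+1 rho) in cvgV; last first.
      apply/seteqP; split => x /=.
        by move=> [k _] /lt_trans; apply; rewrite gtrBl invr_gt0.
      rewrite /eball/= => xrho.
      have d0 : 0 < rho - enorm x by rewrite subr_gt0.
      exists (Num.truncn (rho - enorm x)^-1) => //=.
      rewrite ltrBrDl -ltrBrDr invf_plt ?posrE//; exact: truncnS_gt.
    rewrite -[leLHS](cvg_lim _ cvgV)//; apply: lime_le; first exact: cvgP cvgV.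
    by apply: nearW => k; apply/ltW/below; rewrite gtrBl invr_gt0.
  (* Lower bound: the balls of radius rho + 1/(k+1), of volume at least c, decrease to the closed
     ball, which differs from the open one by a null sphere. *)
  have cvgV : (mu \o (fun k => @eball R n.+1 (rho + k.+1%:R^-1))) k
      @[k --> \oo] --> mu (\bigcap_k @eball R n.+1 (rho + k.+1%:R^-1)).
    apply: nonincreasing_cvg_mu.
    - by rewrite -ge0_fin_numE ?measure_ge0//; exact: vball_fin_num.
    - by move=> k; exact: measurable_eball.
    - by apply: bigcap_measurable => // k _; exact: measurable_eball.
    - move=> i j ij; apply/subsetPset => x /lt_le_trans; apply.
      by rewrite lerD2l lef_pV2 ?posrE// ler_nat ltnS.
  rewrite (_ : \bigcap_k _ =
      @eball R n.+1 rho `|` [set x | enorm x = rho]) in cvgV; last first.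
    apply/seteqP; split => x /=; last first.
      move=> h k _; rewrite /eball/=.
      apply: (@le_lt_trans _ _ rho); last by rewrite ltrDl invr_gt0.
      by case: h => [/ltW|->].
    rewrite /eball/= => h.
    have [|xrho|->] := ltgtP (enorm x) rho; [by left| |by right].
    exfalso; have d0 : 0 < enorm x - rho by rewrite subr_gt0.
    have := h (Num.truncn (enorm x - rho)^-1) I.
    rewrite /eball/= -ltrBlDl ltNge => /negP; apply.
    by rewrite invf_ple ?posrE//; exact/ltW/truncnS_gt.
  have -> : V rho = mu (@eball R n.+1 rho `|` [set x | enorm x = rho]).
    rewrite /vball measureU.
    - by rewrite [X in (_ + X)%E](lebesgue_sphere rho) adde0.
    - exact: measurable_eball.
    - exact: measurable_sphere.
    - apply/seteqP; split => x //= [+ xr].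
      by rewrite /eball/= xr ltxx.
  rewrite -[leRHS](cvg_lim _ cvgV)//; apply: lime_ge; first exact: cvgP cvgV.
  by apply: nearW => k; apply: above; rewrite ltrDl invr_gt0.
exists rho; split => // x; apply/idP/idP; last exact: below.
(* If |x| >= rho the volume is at least c; the boundary case |x| = rho gives exactly c. *)
rewrite ltNge; apply: contraNlt; rewrite le_eqVlt => /predU1P[<-|/above//].
by rewrite Vrho.
Qed.

End ball_volume.

(** * Central means *)

Section means.
Context {R : realType} (n : nat).
Notation T := (lebesgue_space R n.+1).
Notation mu := (@lebesgue R n.+1).
Notation V := (@vball R n.+1).

Definition ball_volume (x : T) : R := fine (V (enorm x)).
Notation W := ball_volume.

Lemma ball_volumeE (x : T) : (W x)%:E = V (enorm x).
Proof. by rewrite fineK// vball_fin_num. Qed.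

Lemma ball_volume_ge0 (x : T) : 0 <= W x.
Proof. by rewrite -lee_fin ball_volumeE measure_ge0. Qed.

Lemma le_ball_volume (x y : T) : enorm x <= enorm y -> W x <= W y.
Proof. by move=> xy; rewrite -lee_fin !ball_volumeE le_vball. Qed.

Lemma measurable_enorm_lebesgue : measurable_fun setT (fun x : T => enorm x).
Proof.
move=> _ Y mY; rewrite setTI; apply: measurable_lebesgue_space.
by rewrite -[X in measurable X]setTI; apply: measurable_enorm.
Qed.

Lemma measurable_ball_volume : measurable_fun setT (W : T -> measurableTypeR R).
Proof.
apply: (@measurableT_comp _ _ _ _ _ _ (fun rho => fine (V rho))).
  apply: nondecreasing_measurable => // rho rho' le_rho.
  by rewrite -lee_fin !fineK ?vball_fin_num// le_vball.
exact: measurable_enorm_lebesgue.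
Qed.

(** By [vball_level] the sublevel set is itself a ball, of volume c. *)
Lemma ball_volume_distribution (c : R) : 0 < c ->
  mu [set x | W x < c] = c%:E.
Proof.
move=> c0; have [rho [Vrho cE]] := vball_level n _ c0.
rewrite -Vrho.
by congr (mu _); apply/seteqP; split => x; rewrite /= -lte_fin ball_volumeE cE.
Qed.

(* The complement of the origin, up to a null set (all that is used). *)
Definition punctured : set T := [set x | 0 < W x].
Notation P := punctured.

Lemma measurable_punctured : measurable P.
Proof.
rewrite (_ : P = W @^-1` (`]0, +oo[%classic : set (measurableTypeR R))).
  rewrite -[X in measurable X]setTI; apply: measurable_ball_volume => //.
by apply/seteqP; split => x /=; rewrite in_itv/= andbT.
Qed.

(** The complement is contained in {W < e}, which has measure e, for every e > 0. *)
Lemma lebesgue_puncturedC : mu (~` P) = 0%E.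
Proof.
apply/eqP; rewrite eq_le measure_ge0 andbT; apply/lee_addgt0Pr => e e0.
rewrite add0e -(ball_volume_distribution e e0); apply: le_measure; rewrite ?inE.
- exact/measurableC/measurable_punctured.
- rewrite (_ : [set _ | _] =
      W @^-1` (`]-oo, e[%classic : set (measurableTypeR R))).
    rewrite -[X in measurable X]setTI; apply: measurable_ball_volume => //.
  by apply/seteqP; split => x /=; rewrite in_itv.
- by move=> x /negP; rewrite -leNgt => /le_lt_trans; apply.
Qed.

Lemma integral_punctured (D : set T) (f : T -> \bar R) : measurable D ->
  measurable_fun D f -> (forall x, D x -> (0 <= f x)%E) ->
  (\int[mu]_(x in D) f x = \int[mu]_(x in D `&` P) f x)%E.
Proof.
move=> mD mf f0; rewrite -[in RHS](setCK P) -setDE.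
apply: ge0_negligible_integral => //; last exact: lebesgue_puncturedC.
exact/measurableC/measurable_punctured.
Qed.

Section relation.
Local Open Scope ereal_scope.
Variables (r s alpha gamma : R) (f : 'rV[R]_n.+1 -> R) (S : set (T * T)).
Hypotheses (r0 : r != 0%R) (s0 : (0 < s)%R) (rs : (r < s)%R).
Hypotheses (mf : measurable_fun [set: T] f) (mS : measurable S).
Let b := (alpha - gamma * r / s)%R.
Hypothesis b0 : b != 0%R.
Hypothesis H1 : forall y, P y ->
  \int[mu]_(x in ysection S y `&` P) (`|b| * W x `^ (b - 1))%:E
    = (W y `^ b)%:E.
Hypothesis H2 : forall x, P x ->
  \int[mu]_(y in xsection S x `&` P) (`|b| * W y `^ (- b - 1))%:E
    = (W x `^ (- b))%:E.

(** An abstract relation S covers balls and their complements at once. Off the null set where W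
    vanishes, the extended powers of V are real powers of W, which reduces the claim to
    [hardy_sections] with p = s/r. *)
Lemma hardy_relation :
  \int[mu]_y (epow (V (enorm y)) (gamma - 1) *
    epow (epow ((epow (V (enorm y)) alpha)^-1 *
      \int[mu]_(x in ysection S y)
        (epow (V (enorm x)) (alpha - 1) * epow `|f x|%:E r)) r^-1) s) <=
  ((`|b| `^ (s / r))^-1)%:E *
    \int[mu]_y (epow (V (enorm y)) (gamma - 1) * epow `|f y|%:E s).
Proof.
have sN0 : s != 0%R by rewrite gt_eqF.
have rV0 : (r^-1)%R != 0%R by rewrite invr_eq0.
pose g (x : T) := epow `|f x|%:E r.
have f0 (x : T) : 0 <= `|f x|%:E by rewrite lee_fin.
have g0 (x : T) : 0 <= g x by exact: epow_ge0.
have mg : measurable_fun [set: T] g.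
  apply: (measurableT_comp (measurable_epow r)); apply/measurable_EFinP.
  exact: measurableT_comp.
have V0 (x : T) p : 0 <= epow (V (enorm x)) p.
  by rewrite epow_ge0// measure_ge0.
have mV p : measurable_fun [set: T] (fun x => epow (V (enorm x)) p).
  apply: (measurableT_comp (measurable_epow p)).
  under eq_fun do rewrite -ball_volumeE.
  by apply/measurable_EFinP; exact: measurable_ball_volume.
have VE (x : T) p : P x -> epow (V (enorm x)) p = (W x `^ p)%:E.
  by move=> Px; rewrite -ball_volumeE epow_EFin.
have mP := measurable_punctured.
pose F (z : T * T) := epow (V (enorm z.1)) (alpha - 1) * g z.1.
have F0 z : 0 <= F z by rewrite mule_ge0 ?V0 ?g0.
have mF : measurable_fun setT F.
  apply: emeasurable_funM.
    exact: (measurableT_comp (mV (alpha - 1)%R) measurable_fst).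
  exact: (measurableT_comp mg measurable_fst).
pose I (y : T) := \int[mu]_(x in ysection S y) F (x, y).
have I0 y : 0 <= I y by exact: integral_ge0.
have mI : measurable_fun setT I by exact: measurable_integral_ysection.
pose X (y : T) := epow (V (enorm y)) (- alpha) * I y.
have X0 y : 0 <= X y by rewrite mule_ge0 ?V0.
have mX : measurable_fun setT X.
  by apply: emeasurable_funM; [exact: mV|exact: mI].
(* The inner exponent 1/r and the outer exponent s merge into s/r, also when the bracket is 0 or
   +oo. *)
have epow_mean y : epow (epow ((epow (V (enorm y)) alpha)^-1 * I y) r^-1) s =
    epow (X y) (s / r).
  rewrite inve_epow ?measure_ge0// -/(X y).
  by rewrite (epow_epow _ _ _ (X0 y) rV0 sN0) mulrC.
under eq_integral do rewrite epow_mean.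
pose E := S `&` (P `*` P).
have mE : measurable E by apply: measurableI => //; exact: measurableX.
have ysE y : P y -> ysection E y = ysection S y `&` P.
  move=> Py; apply/seteqP; split => x; rewrite /ysection/= !inE.
    by move=> [? []].
  by move=> [? ?].
have xsE x : P x -> xsection E x = xsection S x `&` P.
  move=> Px; apply/seteqP; split => y; rewrite /xsection/= !inE.
    by move=> [? []].
  by move=> [? ?].
(* From r < s and s > 0 it follows that s/r is above 1 for r > 0 and negative for r < 0, the range
   of exponents in [jensen_epow]. *)
have p1 : (1 < s / r \/ s / r < 0)%R.
  have [r_gt0|r_lt0|r_eq0] := ltgtP 0%R r.
  - by left; rewrite ltr_pdivlMr// mul1r.
  - by right; rewrite pmulr_rlt0// invr_lt0.
  - by move: r0; rewrite -r_eq0 eqxx.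
have bE : (alpha - gamma / (s / r) = b)%R.
  by rewrite /b invf_div mulrA.
(* This is valid also where f vanishes: for r < 0 the value 0 goes to +oo under the power r and back
   to 0 under s/r. *)
have gE (x : T) : epow (g x) (s / r) = epow `|f x|%:E s.
  by rewrite epow_epow ?mulf_neq0 ?invr_eq0// mulrC divfK.
have integrandL y : P y -> epow (V (enorm y)) (gamma - 1) * epow (X y) (s / r) =
    (W y `^ (gamma - 1))%:E * epow ((W y `^ (- alpha))%:E *
      \int[mu]_(x in ysection E y) ((W x `^ (alpha - 1))%:E * g x)) (s / r).
  move=> Py; rewrite /X !VE//; congr (_ * epow (_ * _) _).
  transitivity (\int[mu]_(x in ysection S y `&` P) F (x, y)).
    apply: integral_punctured; first exact: measurable_ysection.
      apply: measurable_funTS; apply: emeasurable_funM; first exact: mV.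
      exact: mg.
    by move=> x _; exact: F0.
  rewrite ysE//; apply: eq_integral => x; rewrite inE => -[_ Px].
  by rewrite /F/= VE.
have integrandR y : P y -> epow (V (enorm y)) (gamma - 1) * epow `|f y|%:E s =
    (W y `^ (gamma - 1))%:E * epow (g y) (s / r).
  by move=> Py; rewrite VE// gE.
have -> : \int[mu]_y (epow (V (enorm y)) (gamma - 1) * epow (X y) (s / r)) =
    \int[mu]_(y in P) ((W y `^ (gamma - 1))%:E * epow ((W y `^ (- alpha))%:E *
      \int[mu]_(x in ysection E y) ((W x `^ (alpha - 1))%:E * g x)) (s / r)).
  rewrite (integral_punctured setT _ measurableT) ?setTI.
  - by apply: eq_integral => y /set_mem Py; exact: integrandL.
  - apply: emeasurable_funM; first exact: mV.
    exact: (measurableT_comp (measurable_epow (s / r))).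
  - by move=> y _; rewrite mule_ge0 ?V0// epow_ge0.
have -> : \int[mu]_y (epow (V (enorm y)) (gamma - 1) * epow `|f y|%:E s) =
    \int[mu]_(y in P) ((W y `^ (gamma - 1))%:E * epow (g y) (s / r)).
  rewrite (integral_punctured setT _ measurableT) ?setTI.
  - by apply: eq_integral => y /set_mem Py; exact: integrandR.
  - apply: emeasurable_funM; first exact: mV.
    apply: (measurableT_comp (measurable_epow s)); apply/measurable_EFinP.
    exact: measurableT_comp.
  - by move=> y _; rewrite mule_ge0 ?V0// epow_ge0.
rewrite -bE; apply: hardy_sections; rewrite ?bE//.
- exact: measurable_ball_volume.
- by move=> x y [_ []].
- by move=> y Py; rewrite ysE//; exact: H1.
- by move=> x Px; rewrite xsE//; exact: H2.
Qed.

End relation.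

End means.

(** * Normalizations for balls and their complements *)

Section relations.
Context {R : realType} (n : nat).
Notation T := (lebesgue_space R n.+1).
Notation mu := (@lebesgue R n.+1).
Notation W := (@ball_volume R n).
Notation P := (@punctured R n).
Implicit Types (b : R) (x y : T).

(* Its section at [y] is the ball of radius |y|. *)
Definition closer : set (T * T) := [set z | enorm z.1 < enorm z.2].

Lemma measurable_closer : measurable closer.
Proof.
have m1 : measurable_fun [set: T * T] (fun z => enorm z.1).
  exact: (measurableT_comp (measurable_enorm_lebesgue n) measurable_fst).
have m2 : measurable_fun [set: T * T] (fun z => enorm z.2).
  exact: (measurableT_comp (measurable_enorm_lebesgue n) measurable_snd).
have := @measurable_fun_ltr _ _ _ _ _ _ m1 m2 measurableT [set true] I.
by rewrite setTI.
Qed.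

Lemma ysection_closer y : ysection closer y = eball (enorm y).
Proof. by apply/seteqP; split => x; rewrite /ysection/= inE. Qed.

Lemma ysection_closerC y : ysection (~` closer) y = ~` eball (enorm y).
Proof. by apply/seteqP; split => x; rewrite /ysection/= inE. Qed.

Lemma lt_ball_volume x y : W x < W y -> enorm x < enorm y.
Proof. by apply: contraTT; rewrite -!leNgt; exact: le_ball_volume. Qed.

Local Open Scope ereal_scope.

Let sublevel b v (S : set T) := @integral_powR_sublevel R _ T mu W
  (measurable_ball_volume n) (ball_volume_ge0 n) (ball_volume_distribution n)
  b v S.
Let superlevel b v (S : set T) := @integral_powR_superlevel R _ T mu W
  (measurable_ball_volume n) (ball_volume_ge0 n) (ball_volume_distribution n)
  b v S.

Let mysection (S : set (T * T)) y : measurable S ->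
  measurable (ysection S y `&` P).
Proof.
move=> mS; apply: measurableI; last exact: measurable_punctured.
exact: measurable_ysection.
Qed.

Let mxsection (S : set (T * T)) x : measurable S ->
  measurable (xsection S x `&` P).
Proof.
move=> mS; apply: measurableI; last exact: measurable_punctured.
exact: measurable_xsection.
Qed.

(** A smaller volume forces a smaller norm, and a smaller norm gives at most the same volume; so the
    section lies between a strict and a non-strict sublevel set of W. *)
Lemma integral_ysection_closer b y : (0 < b)%R -> P y ->
  \int[mu]_(x in ysection closer y `&` P) (b * W x `^ (b - 1))%:E
    = (W y `^ b)%:E.
Proof.
move=> b0 Py; apply: sublevel => //.
  exact: (mysection _ _ measurable_closer).
  move=> x /andP[x0 xy]; split => //; rewrite /ysection/= inE.
  exact: lt_ball_volume.
move=> x [+ Px]; rewrite /ysection/= inE => xy; apply/andP; split => //.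
exact/le_ball_volume/ltW.
Qed.

Lemma integral_xsection_closer b x : (0 < b)%R -> P x ->
  \int[mu]_(y in xsection closer x `&` P) (b * W y `^ (- b - 1))%:E
    = (W x `^ (- b))%:E.
Proof.
move=> b0 Px; apply: superlevel => //.
  exact: (mxsection _ _ measurable_closer).
  move=> y xy; split; last exact: lt_trans xy.
  by rewrite /xsection/= inE; exact: lt_ball_volume.
by move=> y [+ _]; rewrite /xsection/= inE => /ltW/le_ball_volume.
Qed.

(** Passing to the complement exchanges sublevel and superlevel sets. Here b is positive and stands
    for the opposite of the b in [hardy_relation]. *)
Lemma integral_ysection_closerC b y : (0 < b)%R -> P y ->
  \int[mu]_(x in ysection (~` closer) y `&` P) (b * W x `^ (- b - 1))%:E
    = (W y `^ (- b))%:E.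
Proof.
move=> b0 Py; apply: superlevel => //.
- exact: (mysection _ _ (measurableC measurable_closer)).
- move=> x yx; split; last exact: lt_trans yx.
  rewrite /ysection/= inE => /=; apply/negP; rewrite -leNgt ltW//.
  exact: lt_ball_volume.
- move=> x [+ _]; rewrite /ysection/= inE => /negP; rewrite -leNgt.
  exact: le_ball_volume.
Qed.

Lemma integral_xsection_closerC b x : (0 < b)%R -> P x ->
  \int[mu]_(y in xsection (~` closer) x `&` P) (b * W y `^ (b - 1))%:E
    = (W x `^ b)%:E.
Proof.
move=> b0 Px; apply: sublevel => //.
- exact: (mxsection _ _ (measurableC measurable_closer)).
- move=> y /andP[y0 yx]; split => //; rewrite /xsection/= inE => /=.
  by apply/negP; rewrite -leNgt ltW// lt_ball_volume.
- move=> y [+ Py]; rewrite /xsection/= inE => /negP; rewrite -leNgt => yx.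
  by apply/andP; split => //; exact: le_ball_volume.
Qed.

End relations.

Theorem theorem2 (R : realType) (n : nat) (n1 : (1 <= n)%N)
    (r s alpha gamma : R) (rs : r < s) (r0 : r != 0) (s0 : 0 < s)
    (f : 'rV[R]_n -> R)
    (mf : measurable_fun [set: lebesgue_space R n] f)
    (fLloc : Lloc r (n%:R * (alpha - 1)) f)
    (fN0 : r < 0 -> {ae @lebesgue R n, forall x, f x != 0}) :
  (0 < alpha - gamma * r / s ->
    (\int[@lebesgue R n]_y
       (epow (vball n (enorm y)) (gamma - 1) *
        epow (central_mean r alpha f (enorm y)) s)
     <= ((alpha - gamma * r / s) `^ (s / r))^-1%:E *
        \int[@lebesgue R n]_y
          (epow (vball n (enorm y)) (gamma - 1) * epow `|f y|%:E s))%E) /\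
  (alpha - gamma * r / s < 0 ->
    (\int[@lebesgue R n]_y
       (epow (vball n (enorm y)) (gamma - 1) *
        epow (companion_mean r alpha f (enorm y)) s)
     <= ((gamma * r / s - alpha) `^ (s / r))^-1%:E *
        \int[@lebesgue R n]_y
          (epow (vball n (enorm y)) (gamma - 1) * epow `|f y|%:E s))%E).
Proof.
(* The dimension is written as a successor, the form in which spheres are null and the total volume
   is infinite. *)
case: n n1 f mf fLloc fN0 => // n _ f mf _ _.
split => b0.
  (* In case (i) the sections of [closer] are the balls, and |b| = b. *)
  have := @hardy_relation R n r s alpha gamma f (closer n) r0 s0 rs mf
    (measurable_closer n) _ _ _.
  rewrite (gtr0_norm b0) (gt_eqF b0) => /(_ isT).
  move=> /(_ (fun y => integral_ysection_closer n _ y b0))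
    /(_ (fun x => integral_xsection_closer n _ x b0)).
  by under eq_integral do rewrite ysection_closer.
(* Case (ii) uses the complementary relation, with |b| = -b = gamma r/s - alpha. *)
have b0' : 0 < gamma * r / s - alpha by rewrite subr_gt0 -subr_lt0.
have := @hardy_relation R n r s alpha gamma f (~` closer n) r0 s0 rs mf
  (measurableC (measurable_closer n)) _ _ _.
rewrite (ltr0_norm b0) (lt_eqF b0) opprB => /(_ isT).
have bE : alpha - gamma * r / s = - (gamma * r / s - alpha) by rewrite opprB.
rewrite bE.
move=> /(_ (fun y => integral_ysection_closerC n _ y b0'))
  /(_ (fun x => integral_xsection_closerC n _ x b0')).
by under eq_integral do rewrite ysection_closerC.
Qed.
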